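(* Let $\mathcal G$ be a finite simplicial graph with vertex set $V$, and let $(G_v)_{v\in V}$ and $(H_v)_{v\in V}$ be two families of finite groups such that $G_v$ and $H_v$ have the same cardinality for each $v\in V$. Then the graph products $\Gamma(\mathcal G,(G_v)_{v\in V})$ and $\Gamma(\mathcal G,(H_v)_{v\in V})$ are abstractly commensurable, i.e. they have isomorphic finite index subgroups.
   Context: The graph product $\Gamma(\mathcal G,(G_v)_{v\in V})$ is the quotient of the free product $\ast_{v\in V}G_v$ by the normal subgroup generated by all commutators $g_vg_wg_v^{-1}g_w^{-1}$ with $g_v\in G_v$, $g_w\in G_w$ and $v\ne w$ adjacent in $\mathcal G$. *)

(* Defs.v *)
From HB Require Import structures.
From mathcomp Require Import all_boot fingroup generic_quotient.
From mathcomp Require Import boolp classical_sets functions cardinality.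

Set Implicit Arguments.
Unset Strict Implicit.
Unset Printing Implicit Defensive.

Local Open Scope classical_set_scope.
Local Open Scope group_scope.
Local Open Scope quotient_scope.

Section Subgroups.
Variable G : groupType.
Implicit Types A N S : set G.

Definition subgroup A :=
  [/\ A 1, forall x y, A x -> A y -> A (x * y) & forall x, A x -> A x^-1].

Definition normal_subgroup N :=
  subgroup N /\ forall x y, N x -> N (x ^ y).

Definition left_coset A (x : G) : set G := [set x * a | a in A].

Definition finite_index A := finite_set [set left_coset A x | x in setT].

Definition normal_closure S : set G :=
  \bigcap_(N in [set N | normal_subgroup N /\ S `<=` N]) N.

Lemma normal_closureP S : normal_subgroup (normal_closure S).
Proof.
split; first split; first by move=> N [[[]]].
- move=> x y Sx Sy N SN; case: (SN) => [[[_ NM _] _] _].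
  by apply: NM; [exact: Sx | exact: Sy].
- by move=> x Sx N SN; case: (SN) => [[[_ _ NV] _] _]; apply: NV; exact: Sx.
- by move=> x y Sx N SN; case: (SN) => [[_ NJ] _]; apply: NJ; exact: Sx.
Qed.

End Subgroups.

Section QuotientGroup.
Variables (G : groupType) (N : set G) (nN : normal_subgroup N).
Implicit Types x y z : G.

Let N1 : 1 \in N. Proof. by apply/mem_set; case: nN => -[]. Qed.
Let NM x y : x \in N -> y \in N -> x * y \in N.
Proof. by rewrite !inE; case: nN => -[_ NM _] _; apply: NM. Qed.
Let NV x : x \in N -> x^-1 \in N.
Proof. by rewrite !inE; case: nN => -[_ _ NV] _; apply: NV. Qed.
Let NJ x y : x \in N -> x ^ y \in N.
Proof. by rewrite !inE; case: nN => _; apply. Qed.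

(* The relation does not use the normality proof, but carrying it in the term
   lets canonical structure inference recover it, so that the quotient type is
   canonically a group. *)
Definition same_coset (_ : normal_subgroup N) : rel G :=
  fun x y => x^-1 * y \in N.

Lemma same_coset_is_equiv : equiv_class_of (same_coset nN).
Proof.
split=> [x|x y|y x z]; rewrite /same_coset.
- by rewrite mulVg N1.
- by apply/idP/idP => /NV; rewrite invgM invgK.
- by move=> Nxy Nyz; rewrite -[z](mulVKg y) mulgA NM.
Qed.

Canonical same_coset_equiv := EquivRelPack same_coset_is_equiv.

Definition quotient_group := {eq_quot same_coset_equiv}.

HB.instance Definition _ := EqQuotient.on quotient_group.
HB.instance Definition _ := Choice.on quotient_group.

Definition quo_one : quotient_group := lift_cst quotient_group 1.
Definition quo_mul := lift_op2 quotient_group (fun x y => x * y).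
Definition quo_inv := lift_op1 quotient_group (fun x => x^-1).

Canonical pi_quo_one_morph := PiConst quo_one.

Lemma same_coset_repr x : x^-1 * repr (\pi_quotient_group x) \in N.
Proof. by have /eqmodP : x = repr (\pi_quotient_group x) %[mod quotient_group]
  by rewrite reprK. Qed.

Lemma pi_quo_mul : {morph \pi : x y / x * y >-> quo_mul x y}.
Proof.
unlock quo_mul => x y; apply/eqmodP; rewrite /= /same_coset.
set x' := repr _; set y' := repr _.
suff -> : (x * y)^-1 * (x' * y') = (x^-1 * x') ^ y * (y^-1 * y').
  by rewrite NM ?NJ ?same_coset_repr.
by rewrite /conjg invgM !mulgA mulgK.
Qed.
Canonical pi_quo_mul_morph := PiMorph2 pi_quo_mul.

Lemma pi_quo_inv : {morph \pi : x / x^-1 >-> quo_inv x}.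
Proof.
unlock quo_inv => x; apply/eqmodP; rewrite /= /same_coset invgK.
set x' := repr _.
have /NV/(NJ x'^-1) : x^-1 * x' \in N by apply: same_coset_repr.
by rewrite /conjg invgM !invgK !mulgA mulgV mul1g.
Qed.
Canonical pi_quo_inv_morph := PiMorph1 pi_quo_inv.

Lemma quo_mulA : associative quo_mul.
Proof.
by elim/quotW=> x; elim/quotW=> y; elim/quotW=> z; rewrite !piE mulgA.
Qed.
Lemma quo_1mul : left_id quo_one quo_mul.
Proof. by elim/quotW=> x; rewrite !piE mul1g. Qed.
Lemma quo_mul1 : right_id quo_one quo_mul.
Proof. by elim/quotW=> x; rewrite !piE mulg1. Qed.
Lemma quo_Vmul : left_inverse quo_one quo_inv quo_mul.
Proof. by elim/quotW=> x; rewrite !piE mulVg. Qed.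
Lemma quo_mulV : right_inverse quo_one quo_inv quo_mul.
Proof. by elim/quotW=> x; rewrite !piE mulgV. Qed.

HB.instance Definition _ :=
  isGroup.Build quotient_group quo_mulA quo_1mul quo_mul1 quo_Vmul quo_mulV.

End QuotientGroup.

Section FreeProduct.
Variables (V : choiceType) (G : V -> groupType).

Definition word := seq {v : V & G v}.
Implicit Types s t : word.

(* The congruence on words generated by the multiplication tables of the G v:
   concatenation modulo word_eqv is the free product of the family. *)
Inductive word_eqv : word -> word -> Prop :=
| word_eqv_refl s : word_eqv s s
| word_eqv_sym s t : word_eqv s t -> word_eqv t s
| word_eqv_trans s t u : word_eqv s t -> word_eqv t u -> word_eqv s u
| word_eqv_cat s s' t t' :
    word_eqv s s' -> word_eqv t t' -> word_eqv (s ++ t) (s' ++ t')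
| word_eqv_one v : word_eqv [:: Tagged G (1 : G v)] [::]
| word_eqv_mul v (x y : G v) :
    word_eqv [:: Tagged G x; Tagged G y] [:: Tagged G (x * y)].

Definition word_eqvb : rel word := fun s t => `[< word_eqv s t >].

Lemma word_eqvb_is_equiv : equiv_class_of word_eqvb.
Proof.
split=> [s|s t|t s u].
- exact/asboolP/word_eqv_refl.
- by apply/asboolP/asboolP; apply: word_eqv_sym.
- by move=> /asboolP st /asboolP tu; apply/asboolP/(word_eqv_trans st).
Qed.

Canonical word_eqvb_equiv := EquivRelPack word_eqvb_is_equiv.

Definition free_product := {eq_quot word_eqvb_equiv}.

HB.instance Definition _ := EqQuotient.on free_product.
HB.instance Definition _ := Choice.on free_product.

Definition word_inv s : word :=
  rev [seq Tagged G ((tagged l)^-1 : G (tag l)) | l <- s].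

Lemma word_inv_eqv s t : word_eqv s t -> word_eqv (word_inv s) (word_inv t).
Proof.
elim=> {s t} [s|s t _|s t u _ IH1 _|s s' t t' _ IH1 _ IH2|v|v x y].
- exact: word_eqv_refl.
- exact: word_eqv_sym.
- exact: word_eqv_trans.
- by rewrite /word_inv !map_cat !rev_cat; apply: word_eqv_cat.
- by rewrite /word_inv /= invg1; apply: word_eqv_one.
- by rewrite /word_inv /= invgM; apply: word_eqv_mul.
Qed.

Lemma word_mulV s : word_eqv (s ++ word_inv s) [::].
Proof.
elim: s => [|[v x] s IH]; first exact: word_eqv_refl.
have -> : (existT _ v x :: s) ++ word_inv (existT _ v x :: s) =
    [:: Tagged G x] ++ (s ++ word_inv s) ++ [:: Tagged G x^-1].
  by rewrite /word_inv /= rev_cons -cats1 -catA.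
apply: word_eqv_trans (word_eqv_one v).
rewrite -[in X in word_eqv _ X](mulgV x).
apply: word_eqv_trans (word_eqv_mul x x^-1).
apply: (word_eqv_cat (word_eqv_refl [:: _])).
exact: word_eqv_cat IH (word_eqv_refl [:: _]).
Qed.

Lemma word_invK s : word_inv (word_inv s) = s.
Proof.
rewrite /word_inv map_rev revK -map_comp map_id_in // => -[v x] _ /=.
by rewrite invgK.
Qed.

Definition fp_one : free_product := lift_cst free_product ([::] : word).
Definition fp_mul := lift_op2 free_product (fun s t : word => s ++ t).
Definition fp_inv := lift_op1 free_product word_inv.

Canonical pi_fp_one_morph := PiConst fp_one.

Lemma word_eqv_repr s : word_eqv s (repr (\pi_free_product s)).
Proof. by apply/asboolP; have /eqmodP :
  s = repr (\pi_free_product s) %[mod free_product] by rewrite reprK. Qed.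

Lemma pi_fp_mul : {morph \pi : s t / (s ++ t : word) >-> fp_mul s t}.
Proof.
unlock fp_mul => s t; apply/eqmodP/asboolP.
by apply: word_eqv_cat; apply: word_eqv_repr.
Qed.
Canonical pi_fp_mul_morph := PiMorph2 pi_fp_mul.

Lemma pi_fp_inv : {morph \pi : s / word_inv s >-> fp_inv s}.
Proof.
unlock fp_inv => s; apply/eqmodP/asboolP.
by apply: word_inv_eqv; apply: word_eqv_repr.
Qed.
Canonical pi_fp_inv_morph := PiMorph1 pi_fp_inv.

Lemma fp_mulA : associative fp_mul.
Proof.
by elim/quotW=> x; elim/quotW=> y; elim/quotW=> z; rewrite !piE catA.
Qed.
Lemma fp_1mul : left_id fp_one fp_mul.
Proof. by elim/quotW=> x; rewrite !piE. Qed.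
Lemma fp_mul1 : right_id fp_one fp_mul.
Proof. by elim/quotW=> x; rewrite !piE cats0. Qed.
Lemma fp_mulV : right_inverse fp_one fp_inv fp_mul.
Proof. by elim/quotW=> x; rewrite !piE; apply/eqmodP/asboolP/word_mulV. Qed.
Lemma fp_Vmul : left_inverse fp_one fp_inv fp_mul.
Proof.
elim/quotW=> x; rewrite !piE; apply/eqmodP/asboolP.
by rewrite -[X in _ ++ X]word_invK; apply: word_mulV.
Qed.

HB.instance Definition _ :=
  isGroup.Build free_product fp_mulA fp_1mul fp_mul1 fp_Vmul fp_mulV.

Definition fp_in v (x : G v) : free_product := \pi [:: Tagged G x].

End FreeProduct.

Section GraphProduct.
Variables (V : choiceType) (adj : rel V) (G : V -> groupType).

Definition edge_commutators : set (free_product G) :=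
  [set c | exists v w (x : G v) (y : G w), [/\ v != w, adj v w &
     c = fp_in x * fp_in y * (fp_in x)^-1 * (fp_in y)^-1]].

Definition graph_product : groupType :=
  quotient_group (normal_closureP edge_commutators).

End GraphProduct.

Definition isomorphic_subgroups (G H : groupType) (A : set G) (B : set H) :=
  exists f : G -> H, {in A &, {morph f : x y / x * y}} /\ set_bij A B f.

Definition commensurable (G H : groupType) :=
  exists (A : set G) (B : set H),
    [/\ subgroup A, finite_index A, subgroup B, finite_index B &
        isomorphic_subgroups A B].

(* Main.v *)
Require Import Defs.
From mathcomp Require Import all_boot fingroup generic_quotient.
From mathcomp Require Import boolp classical_sets functions cardinality.

(** The kernel of the map from the graph product to the direct product of its
    vertex groups depends only on the vertex groups as sets.  Label the elements
    of [G v] and of [H v] by a common set [T v].  Both graph products act on the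
    labellings [p] in the product of the [T v]: a letter [x] of [G v] moves only
    the coordinate [p v].  A word over [G] started at [p] traces a path of
    labellings, and spelling this path with letters of [H] gives a word over
    [H].  This transcription respects the defining relations, satisfies the
    cocycle identity [c p (g * h) = c p g * c (p.g) h], and is inverted by the
    transcription in the other direction.  At a fixed base labelling it is thus
    a bijection between the graph products which maps the stabilizer of the base
    labelling onto the corresponding stabilizer and is multiplicative there;
    stabilizers have finite index because there are finitely many labellings. *)

Set Implicit Arguments.
Unset Strict Implicit.
Unset Printing Implicit Defensive.

Local Open Scope classical_set_scope.
Local Open Scope group_scope.
Local Open Scope quotient_scope.

(** * Projections onto free products and quotient groups as homomorphisms *)

Lemma pi_fp_nil (V : choiceType) (G : V -> groupType) :
  \pi_(free_product G) [::] = 1.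
Proof. by rewrite -[RHS]/(fp_one G) piE. Qed.

Lemma pi_fp_cat (V : choiceType) (G : V -> groupType) (s t : word G) :
  \pi_(free_product G) (s ++ t) =
  \pi_(free_product G) s * \pi_(free_product G) t.
Proof. exact: pi_fp_mul. Qed.

Lemma pi_quo1 (G : groupType) (N : set G) (nN : normal_subgroup N) :
  \pi_(quotient_group nN) 1 = 1.
Proof. by rewrite -[RHS]/(quo_one nN) piE. Qed.

Lemma pi_quoM (G : groupType) (N : set G) (nN : normal_subgroup N) (g h : G) :
  \pi_(quotient_group nN) (g * h) =
  \pi_(quotient_group nN) g * \pi_(quotient_group nN) h.
Proof. exact: pi_quo_mul. Qed.

(** * Right actions of a graph product from compatible actions of its vertex groups *)

Section GraphProductAction.
Variables (V : choiceType) (adj : rel V) (G : V -> groupType).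
Local Notation GP := (graph_product adj G).
Local Notation N := (normal_closureP (@edge_commutators V adj G)).

Lemma fp_in1 v : fp_in (1 : G v) = 1.
Proof. by rewrite -pi_fp_nil; exact/eqmodP/asboolP/word_eqv_one. Qed.

Lemma fp_inM v (x y : G v) : fp_in (x * y) = fp_in x * fp_in y.
Proof. by rewrite -pi_fp_cat; exact/esym/eqmodP/asboolP/word_eqv_mul. Qed.

Definition gp_in v (x : G v) : GP := \pi_(quotient_group N) (fp_in x).

Lemma gp_in1 v : gp_in (1 : G v) = 1.
Proof. by rewrite /gp_in fp_in1 pi_quo1. Qed.

Lemma gp_inM v (x y : G v) : gp_in (x * y) = gp_in x * gp_in y.
Proof. by rewrite /gp_in fp_inM pi_quoM. Qed.

Lemma gp_inC v w (x : G v) (y : G w) : v != w -> adj v w ->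
  gp_in x * gp_in y = gp_in y * gp_in x.
Proof.
move=> vw adjvw.
pose c := fp_in x * fp_in y * (fp_in x)^-1 * (fp_in y)^-1.
have c1 : \pi_(quotient_group N) c = 1.
  rewrite -pi_quo1; apply/esym/eqmodP; rewrite /= /same_coset invg1 mul1g.
  by apply/mem_set => M [_]; apply; exists v, w, x, y.
rewrite /gp_in -!pi_quoM -[RHS]mul1g -c1 -pi_quoM.
by rewrite /c !mulgA !mulgKV.
Qed.

(** The letters generate the graph product; adding them on the right matches the right actions
    below. *)
Lemma graph_product_ind (P : GP -> Prop) :
  P 1 -> (forall g v (x : G v), P g -> P (g * gp_in x)) -> forall g, P g.
Proof.
move=> P1 PM; elim/quotW; elim/quotW; elim/last_ind => [|s [v x] IHs].
  by rewrite pi_fp_nil pi_quo1.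
by rewrite -cats1 pi_fp_cat pi_quoM; apply: PM.
Qed.

Variables (X : Type) (act : X -> forall v, G v -> X).
Hypothesis act1 : forall x v, act x (1 : G v) = x.
Hypothesis actM : forall x v (g h : G v), act x (g * h) = act (act x g) h.
Hypothesis actC : forall x v w (g : G v) (h : G w), v != w -> adj v w ->
  act (act x g) h = act (act x h) g.

Definition word_act (x : X) (s : word G) : X :=
  foldl (fun y l => act y (tagged l)) x s.

Lemma word_act_eqv s t : word_eqv s t -> word_act^~ s =1 word_act^~ t.
Proof.
rewrite /word_act.
elim=> {s t} [//|s t _ IH x|s t u _ IH1 _ IH2 x|s s' t t' _ IH1 _ IH2 x|v x|
  v g h x] /=.
- by rewrite IH.
- by rewrite IH1 IH2.
- by rewrite !foldl_cat IH1 IH2.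
- exact: act1.
- by rewrite actM.
Qed.

Definition fp_act (x : X) (g : free_product G) : X := word_act x (repr g).

Lemma fp_act_pi x s : fp_act x (\pi_(free_product G) s) = word_act x s.
Proof. by rewrite /fp_act -(word_act_eqv (word_eqv_repr s)). Qed.

Lemma fp_actM x g h : fp_act x (g * h) = fp_act (fp_act x g) h.
Proof.
elim/quotW: g => s; elim/quotW: h => t.
by rewrite -pi_fp_cat !fp_act_pi /word_act foldl_cat.
Qed.

Lemma fp_act1 x : fp_act x 1 = x.
Proof. by rewrite -pi_fp_nil fp_act_pi. Qed.

Lemma fp_act_in x v (g : G v) : fp_act x (fp_in g) = act x g.
Proof. by rewrite /fp_in fp_act_pi. Qed.

Lemma fp_actK x g : fp_act (fp_act x g) g^-1 = x.
Proof. by rewrite -fp_actM mulgV fp_act1. Qed.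

Lemma fp_actVK x g : fp_act (fp_act x g^-1) g = x.
Proof. by rewrite -fp_actM mulVg fp_act1. Qed.

(** The elements acting trivially form a normal subgroup, which contains the edge commutators by
    [actC]. *)
Lemma fp_act_closure x n :
  normal_closure (@edge_commutators V adj G) n -> fp_act x n = x.
Proof.
move=> Nn; move: x; pose K := [set n | forall x, fp_act x n = x].
apply: (Nn K); split; first split; first split.
- exact: fp_act1.
- by move=> g h Kg Kh x; rewrite fp_actM Kg Kh.
- by move=> g Kg x; rewrite -[in LHS](Kg x) fp_actK.
- by move=> g h Kg x; rewrite /conjg !fp_actM Kg fp_actVK.
move=> _ [v [w [g [h [vw adjvw ->]]]]] x; rewrite !fp_actM.
rewrite [fp_act (fp_act x _) _](_ : _ = fp_act (fp_act x (fp_in h)) (fp_in g)).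
  by rewrite !fp_actK.
by rewrite !fp_act_in actC.
Qed.

Definition gp_act (x : X) (g : GP) : X :=
  fp_act x (repr (g : quotient_group N)).

Lemma gp_act_pi x n : gp_act x (\pi_(quotient_group N) n) = fp_act x n.
Proof.
have /set_mem/fp_act_closure nN := same_coset_repr N n.
(* The representative is [n] times an element of the normal closure, which acts trivially. *)
by rewrite /gp_act -[in LHS](mulVKg n (repr _)) fp_actM nN.
Qed.

Lemma gp_actM x g h : gp_act x (g * h) = gp_act (gp_act x g) h.
Proof.
by elim/quotW: g => m; elim/quotW: h => n; rewrite -pi_quoM !gp_act_pi fp_actM.
Qed.

Lemma gp_act1 x : gp_act x 1 = x.
Proof. by rewrite -pi_quo1 gp_act_pi fp_act1. Qed.

Lemma gp_act_in x v (g : G v) : gp_act x (gp_in g) = act x g.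
Proof. by rewrite /gp_in gp_act_pi fp_act_in. Qed.

End GraphProductAction.

(** * Stabilizers of points in a finite set *)

Section Stabilizer.
Variables (G : groupType) (X : finType) (act : X -> G -> X).
Hypothesis act1 : forall x, act x 1 = x.
Hypothesis actM : forall x g h, act x (g * h) = act (act x g) h.

Lemma subgroup_stabilizer x : subgroup [set g | act x g = x].
Proof.
split=> /= [|g h gx hx|g gx]; first exact: act1.
- by rewrite actM gx hx.
- by rewrite -[in LHS]gx -actM mulgV act1.
Qed.

Lemma finite_index_stabilizer x : finite_index [set g | act x g = x].
Proof.
set A := [set g | _].
(* For a right action, the left coset of [g] is determined by the image of [x] under [g^-1], so
   there are at most as many cosets as points. *)
pose coset_at y := [set g | act x g^-1 = y].
apply: (@sub_finite_set _ _ (coset_at @` setT)); last first.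
  by apply: finite_image; apply: finite_finset.
move=> _ [g _ <-]; exists (act x g^-1) => //; apply/seteqP; split=> h /=.
  rewrite /coset_at /= => hg; exists (g^-1 * h); last by rewrite mulVKg.
  by rewrite /A /= actM -hg -actM mulVg act1.
case=> k kx <-; rewrite /coset_at /= invgM actM -[in LHS]kx -(actM x) mulgV.
by rewrite act1.
Qed.

End Stabilizer.

(** * Labellings and the change of one coordinate *)

Section Labellings.
Variables (V : finType) (adj : rel V) (T : V -> finType).
Local Notation labelling := {dffun forall v, T v}.

Definition relabel (p : labelling) v (t : T v) : labelling :=
  finfun (dfwith p t).

Lemma relabel_in (p : labelling) v (t : T v) : relabel p t v = t.
Proof. by rewrite ffunE dfwith_in. Qed.

Lemma relabel_out (p : labelling) v w (t : T v) :
  v != w -> relabel p t w = p w.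
Proof. by move=> vw; rewrite ffunE dfwith_out. Qed.

Lemma relabel_id (p : labelling) v : relabel p (p v) = p.
Proof.
apply/ffunP => w; have [<-|vw] := eqVneq v w; first by rewrite relabel_in.
by rewrite relabel_out.
Qed.

Lemma relabel_relabel (p : labelling) v (t u : T v) :
  relabel (relabel p t) u = relabel p u.
Proof.
apply/ffunP => w; have [<-|vw] := eqVneq v w; first by rewrite !relabel_in.
by rewrite !relabel_out.
Qed.

Lemma relabelC (p : labelling) v w (t : T v) (u : T w) : v != w ->
  relabel (relabel p t) u = relabel (relabel p u) t.
Proof.
move=> vw; have wv : w != v by rewrite eq_sym.
apply/ffunP => z; have [<-|vz] := eqVneq v z.
  by rewrite relabel_out // !relabel_in.
rewrite [RHS]relabel_out //; have [<-|wz] := eqVneq w z.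
  by rewrite !relabel_in.
by rewrite !relabel_out.
Qed.

(** * The action of the graph product on labellings *)

Section Moves.
Variables (G : V -> groupType) (a : forall v, T v -> G v).
Variable a' : forall v, G v -> T v.
Hypotheses (aK : forall v, cancel (@a v) (@a' v)).
Hypotheses (a'K : forall v, cancel (@a' v) (@a v)).

(** The right regular action of [G v], transported to the labels [T v]. *)
Definition move (p : labelling) v (x : G v) : labelling :=
  relabel p (a' (a (p v) * x)).

Lemma move1 p v : move p (1 : G v) = p.
Proof. by rewrite /move mulg1 aK relabel_id. Qed.

Lemma moveM p v (x y : G v) : move p (x * y) = move (move p x) y.
Proof. by rewrite /move relabel_relabel relabel_in a'K mulgA. Qed.

Lemma moveC p v w (x : G v) (y : G w) : v != w ->
  move (move p x) y = move (move p y) x.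
Proof.
by move=> vw; rewrite /move relabelC // !relabel_out // eq_sym.
Qed.

Definition gp_move : labelling -> graph_product adj G -> labelling :=
  gp_act move.

Lemma gp_move1 p : gp_move p 1 = p.
Proof.
by apply: gp_act1 => *; [exact: move1 | exact: moveM | exact: moveC].
Qed.

Lemma gp_moveM p g h : gp_move p (g * h) = gp_move (gp_move p g) h.
Proof.
by apply: gp_actM => *; [exact: move1 | exact: moveM | exact: moveC].
Qed.

Lemma gp_move_in p v (x : G v) : gp_move p (gp_in adj x) = move p x.
Proof.
by apply: gp_act_in => *; [exact: move1 | exact: moveM | exact: moveC].
Qed.

End Moves.

(** * Transcription of words from one graph product to the other *)

Section Transcription.
Variables (G H : V -> groupType).
Variables (a : forall v, T v -> G v) (a' : forall v, G v -> T v).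
Variable b : forall v, T v -> H v.
Hypothesis aK : forall v, cancel (@a v) (@a' v).
Hypothesis a'K : forall v, cancel (@a' v) (@a v).
Local Notation GP := (graph_product adj G).
Local Notation HP := (graph_product adj H).
Local Notation gp_moveG := (gp_move a a').

(** The unique letter of [H v] that changes the label [p v] in the same way as [x] does. *)
Definition transcribe_letter (p : labelling) v (x : G v) : H v :=
  (b (p v))^-1 * b (a' (a (p v) * x)).

(** Carrying the output along with the labelling turns transcription into an action on pairs, so
    that it respects the relations of the graph product once [step1], [stepM] and [stepC] hold. *)
Definition transcribe_step (z : labelling * HP) v (x : G v) : labelling * HP :=
  (move a a' z.1 x, z.2 * gp_in adj (transcribe_letter z.1 x)).

Let step1 z v : transcribe_step z (1 : G v) = z.
Proof.
case: z => p h; rewrite /transcribe_step /transcribe_letter /= move1 //.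
by rewrite mulg1 aK mulVg gp_in1 mulg1.
Qed.

(** The letters telescope: the label reached by [x] is the one from which [y] starts. *)
Let stepM z v (x y : G v) :
  transcribe_step z (x * y) = transcribe_step (transcribe_step z x) y.
Proof.
case: z => p h; rewrite /transcribe_step /transcribe_letter /= moveM //.
by rewrite /move !relabel_in a'K -!mulgA -gp_inM -mulgA mulVKg.
Qed.

(** A move at [v] leaves the label at [w] alone, so both orders yield the same two letters, and
    these commute in [HP]. *)
Let stepC z v w (x : G v) (y : G w) : v != w -> adj v w ->
  transcribe_step (transcribe_step z x) y =
  transcribe_step (transcribe_step z y) x.
Proof.
case: z => p h vw adjvw; rewrite /transcribe_step /transcribe_letter /=.
by rewrite moveC // -!mulgA gp_inC /move ?relabel_out // eq_sym.
Qed.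

Definition transcribe (p : labelling) (g : GP) : HP :=
  (gp_act transcribe_step (p, 1) g).2.

Lemma gp_act_transcribe_step1 z g :
  (gp_act transcribe_step z g).1 = gp_moveG z.1 g.
Proof.
move: g; apply: graph_product_ind => [|g v x IHg].
  by rewrite gp_act1 // gp_move1.
by rewrite gp_actM // gp_moveM // gp_act_in // gp_move_in //= IHg.
Qed.

(** Steps multiply the output on the right only, so what is already written stays in front. *)
Lemma gp_act_transcribe_step2 p h g :
  (gp_act transcribe_step (p, h) g).2 = h * transcribe p g.
Proof.
rewrite /transcribe; move: g; apply: graph_product_ind => [|g v x IHg].
  by rewrite !gp_act1 // mulg1.
by rewrite !gp_actM // !gp_act_in //= !gp_act_transcribe_step1 IHg mulgA.
Qed.

Lemma transcribe1 p : transcribe p 1 = 1.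
Proof. by rewrite /transcribe gp_act1. Qed.

Lemma transcribeM p g h :
  transcribe p (g * h) = transcribe p g * transcribe (gp_moveG p g) h.
Proof.
rewrite {1}/transcribe gp_actM // [gp_act _ (p, 1) g]surjective_pairing.
by rewrite gp_act_transcribe_step1 gp_act_transcribe_step2.
Qed.

Lemma transcribe_in p v (x : G v) :
  transcribe p (gp_in adj x) = gp_in adj (transcribe_letter p x).
Proof. by rewrite /transcribe gp_act_in //= mul1g. Qed.

Variable b' : forall v, H v -> T v.
Hypothesis bK : forall v, cancel (@b v) (@b' v).
Hypothesis b'K : forall v, cancel (@b' v) (@b v).

(** Each transcribed letter produces the same new label as the original, so both words trace the
    same path. *)
Lemma gp_move_transcribe p g :
  gp_move b b' p (transcribe p g) = gp_moveG p g.
Proof.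
move: g; apply: graph_product_ind => [|g v x IHg].
  by rewrite transcribe1 !gp_move1.
rewrite transcribeM transcribe_in !gp_moveM // IHg !gp_move_in //.
by rewrite {1}/move mulVKg bK.
Qed.

End Transcription.

Lemma transcribeK (G H : V -> groupType)
    (a : forall v, T v -> G v) (a' : forall v, G v -> T v)
    (b : forall v, T v -> H v) (b' : forall v, H v -> T v) p :
  (forall v, cancel (@a v) (@a' v)) -> (forall v, cancel (@a' v) (@a v)) ->
  (forall v, cancel (@b v) (@b' v)) -> (forall v, cancel (@b' v) (@b v)) ->
  cancel (transcribe a a' b p) (transcribe b b' a p).
Proof.
move=> aK a'K bK b'K; apply: graph_product_ind => [|g v x IHg].
  by rewrite !transcribe1.
(* Both transcriptions reach the last letter at the same labelling, which reduces the claim to one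
   letter. *)
rewrite !transcribeM // IHg gp_move_transcribe // !transcribe_in //.
by rewrite /transcribe_letter mulVKg bK a'K mulKg.
Qed.

Lemma commensurable_labelled (G H : V -> groupType) (p : labelling)
    (a : forall v, T v -> G v) (a' : forall v, G v -> T v)
    (b : forall v, T v -> H v) (b' : forall v, H v -> T v) :
  (forall v, cancel (@a v) (@a' v)) -> (forall v, cancel (@a' v) (@a v)) ->
  (forall v, cancel (@b v) (@b' v)) -> (forall v, cancel (@b' v) (@b v)) ->
  commensurable (graph_product adj G) (graph_product adj H).
Proof.
move=> aK a'K bK b'K.
exists [set g | gp_move a a' p g = p], [set h | gp_move b b' p h = p].
split.
- by apply: subgroup_stabilizer => *; rewrite ?gp_move1 ?gp_moveM.
- by apply: finite_index_stabilizer => *; rewrite ?gp_move1 ?gp_moveM.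
- by apply: subgroup_stabilizer => *; rewrite ?gp_move1 ?gp_moveM.
- by apply: finite_index_stabilizer => *; rewrite ?gp_move1 ?gp_moveM.
exists (transcribe a a' b p); split=> [g h /set_mem /= gp _|].
  (* Since [g] fixes [p], the cocycle identity becomes multiplicativity. *)
  by rewrite transcribeM // gp.
split=> [g /= gp | g h _ _ | h /= hp]; first by rewrite gp_move_transcribe.
  exact: (can_inj (transcribeK p aK a'K bK b'K)).
(* The reverse transcription is the preimage; it fixes [p] because [h] does. *)
exists (transcribe b b' a p h); last exact: transcribeK.
by rewrite /= gp_move_transcribe.
Qed.

End Labellings.

Theorem corollary1p5 (V : finType) (adj : rel V)
    (adj_sym : symmetric adj) (adj_irr : irreflexive adj)
    (G H : V -> finGroupType) (cardGH : forall v, #|G v| = #|H v|) :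
  commensurable (graph_product adj G) (graph_product adj H).
Proof.
pose a v (t : 'I_#|G v|) : G v := enum_val t.
pose a' v (x : G v) : 'I_#|G v| := enum_rank x.
pose b v (t : 'I_#|G v|) : H v := enum_val (cast_ord (cardGH v) t).
pose b' v (y : H v) : 'I_#|G v| := cast_ord (esym (cardGH v)) (enum_rank y).
(* Labels are ordinals below the common cardinality; the base labelling is the rank of the identity
   of each [G v]. *)
apply: (@commensurable_labelled V adj (fun v => 'I_#|G v|) G H
  (finfun (fun v => enum_rank (1 : G v))) a a' b b') => v t.
- exact: enum_valK.
- exact: enum_rankK.
- by rewrite /b' /b enum_valK cast_ordK.
- by rewrite /b' /b cast_ordKV enum_rankK.
Qed.
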